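(* Let $(A,\cdot)$ be an idempotent associative algebra over a field $K$ and let $*$ be an associative product on $A$. Then the following are equivalent: (i) $*$ is interchangeable with $\cdot$; (ii) $*$ is totally compatible with $\cdot$.
   Context: All algebras and vector spaces are over a field $K$ and all products are binary and bilinear. An algebra $(A,\cdot)$ is idempotent if $A\cdot A=A$, where $A\cdot A$ is the linear span of all products $a\cdot b$ with $a,b\in A$. An associative product $*$ on $A$ is interchangeable with $\cdot$ if $(a*b)\cdot c=(a\cdot b)*c$ and $a*(b\cdot c)=a\cdot(b*c)$ for all $a,b,c\in A$; it is totally compatible with $\cdot$ if $(a*b)\cdot c=(a\cdot b)*c=a*(b\cdot c)=a\cdot(b*c)$ for all $a,b,c\in A$. *)

(* Defs.v *)
From HB Require Import structures.
From mathcomp Require Import all_boot all_order all_algebra.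

Set Implicit Arguments.
Unset Strict Implicit.
Unset Printing Implicit Defensive.

Import GRing.Theory.
Local Open Scope ring_scope.

(* An algebra is a vector space [A : lmodType K] with a bilinear product
   [{bilinear A -> A -> A}], so that one space can carry several products; no
   unit and no finite dimension is assumed. *)

Definition linear_span (K : fieldType) (V : lmodType K) (S : V -> Prop) (v : V)
  : Prop :=
  exists (n : nat) (c : 'I_n -> K) (u : 'I_n -> V),
    (forall i, S (u i)) /\ v = \sum_(i < n) c i *: u i.

Definition is_product (K : fieldType) (A : lmodType K)
    (mul : {bilinear A -> A -> A}) (x : A) : Prop :=
  exists a b : A, x = mul a b.

(* Only the inclusion of A in A.A has content. *)
Definition idempotent_algebra (K : fieldType) (A : lmodType K)
    (mul : {bilinear A -> A -> A}) : Prop :=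
  forall x : A, linear_span (is_product mul) x.

Definition interchangeable (K : fieldType) (A : lmodType K)
    (dot star : {bilinear A -> A -> A}) : Prop :=
  forall a b c : A,
    dot (star a b) c = star (dot a b) c /\
    star a (dot b c) = dot a (star b c).

Definition totally_compatible (K : fieldType) (A : lmodType K)
    (dot star : {bilinear A -> A -> A}) : Prop :=
  forall a b c : A,
    [/\ dot (star a b) c = star (dot a b) c,
        star (dot a b) c = star a (dot b c) &
        star a (dot b c) = dot a (star b c)].

(* Main.v *)
Require Import Defs.
From HB Require Import structures.
From mathcomp Require Import all_boot all_order all_algebra.

(** Interchangeability already supplies the two outer equalities of total
    compatibility, so what is left is (a.b)*c = a*(b.c), which by
    interchangeability again amounts to (a*b).c = a.(b*c).  Both sides are
    linear in b, and A is spanned by products, so b may be taken of the form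
    x.y; then a factor can be moved across the middle:
    (a*(x.y)).c = (a.(x*y)).c = a.((x*y).c) = a.((x.y)*c). *)

Local Open Scope ring_scope.
Import GRing.Theory.

Lemma linear_span_ind (K : fieldType) (V : lmodType K) (S P : V -> Prop) :
  P 0 -> (forall k u v, S u -> P v -> P (k *: u + v)) ->
  forall v, linear_span S v -> P v.
Proof.
move=> P0 PD v [n [k [u [Su ->]]]].
by elim/big_rec: _ => // i w _; apply: PD.
Qed.

(** Idempotency is applied to the middle argument: writing b as x.y gives the
    rule a*(x.y) = a.(x*y) a product to act on in a*b, and the rule
    (x*y).c = (x.y)*c then rebuilds b inside b*c. *)
Lemma interchangeable_dot_star (K : fieldType) (A : lmodType K)
    (dot star : {bilinear A -> A -> A}) :
  associative dot -> idempotent_algebra dot -> interchangeable dot star ->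
  forall a b c, dot (star a b) c = dot a (star b c).
Proof.
move=> dotA idem inter a b c.
elim/linear_span_ind: b / (idem b) => [|k u v [x [y ->]] IHv].
  by rewrite linear0r linear0l linear0l linear0r.
rewrite linearPr !linearPl linearPr IHv; congr (_ *: _ + _).
by rewrite (inter a x y).2 -dotA (inter x y c).1.
Qed.

Theorem proposition3p1 (K : fieldType) (A : lmodType K)
    (dot star : {bilinear A -> A -> A})
    (dotA : associative dot) (dot_idem : idempotent_algebra dot)
    (starA : associative star) :
  interchangeable dot star <-> totally_compatible dot star.
Proof.
split=> [inter | compat] a b c; last by case: (compat a b c).
have [eql eqr] := inter a b c; split=> //.
by rewrite -eql eqr (interchangeable_dot_star _ _ _ _ dotA).
Qed.
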